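(* Let $G$ be a directed graph with one vertex and $N$ loops $\{e_j\}_{j=1}^N$, where $2\leq N\leq\infty$. Let $\delta$ be a derivation on $\mathcal{A}_G$. If $\delta$ is locally inner at $L_{e_1}$, i.e. there exists $S\in\mathcal{A}_G$ such that $\delta(L_{e_1})=\delta_S(L_{e_1})$, then $\delta$ is an inner derivation, i.e. $\delta=\delta_T$ for some $T\in\mathcal{A}_G$.
   Context: For the one-vertex directed graph $G$ with vertex $v$ and loops $\{e_j\}_{j=1}^N$, $\mathbb{F}_G^+$ is the free semigroup (with unit $v$, the empty path) of all finite words in the $e_j$. $\mathcal{H}_G=\ell^2(\mathbb{F}_G^+)$ has orthonormal basis $\{\xi_w\colon w\in\mathbb{F}_G^+\}$; $L_{e_j}\xi_w=\xi_{e_jw}$ and $L_v=I$. $\mathcal{A}_G$ is the norm-closed algebra generated by $\{I,L_{e_j}\colon 1\leq j\leq N\}$ in $B(\mathcal{H}_G)$ (for $N=\infty$, $j$ ranges over the positive integers). A derivation on $\mathcal{A}_G$ is a linear map $\delta\colon\mathcal{A}_G\to\mathcal{A}_G$ (not assumed bounded) with $\delta(AB)=\delta(A)B+A\delta(B)$; $\delta_T(A)=AT-TA$. *)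

(* Defs.v *)
From HB Require Import structures.
From mathcomp Require Import all_boot all_order all_algebra ring.
From mathcomp Require Import complex.
From mathcomp Require Import all_classical all_reals all_analysis.

Set Implicit Arguments.
Unset Strict Implicit.
Unset Printing Implicit Defensive.
Import Order.TTheory GRing.Theory Num.Theory.
Import numFieldNormedType.Exports.
Import Normc.
Local Open Scope classical_set_scope.
Local Open Scope ring_scope.
Local Open Scope complex_scope.

Section SquareSummable.
Context {R : realType} {I : choiceType}.
Implicit Types (x y : I -> R[i]) (s : seq I).

Definition sqsum x : \bar R := \esum_(i in [set: I]) (normc (x i) ^+ 2)%:E.

Definition ell2_pred : pred (I -> R[i]) := [pred x | (sqsum x < +oo)%E].

Definition ell2_norm x : R := Num.sqrt (fine (sqsum x)).

Lemma sqsum_ge0 x : (0 <= sqsum x)%E.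
Proof. by apply: esum_ge0 => i _; rewrite lee_fin sqr_ge0. Qed.

Lemma sqsum_leP x (M : R) :
  (sqsum x <= M%:E)%E <->
  (forall s, uniq s -> \sum_(i <- s) normc (x i) ^+ 2 <= M).
Proof.
split=> [h s us|h].
  rewrite -lee_fin; apply: le_trans h; rewrite /sqsum.
  apply: esum_ge; exists [set` s].
    by split=> //; exact: finite_seq.
  rewrite -sumEFin le_eqVlt; apply/orP; left; apply/eqP.
  by rewrite -fsbig_seq.
apply: ge_ereal_sup => _ [A [fA _] <-].
by rewrite fsbig_finite//= sumEFin lee_fin; apply: h.
Qed.

Lemma sqsum_fin x : x \in ell2_pred -> sqsum x = (fine (sqsum x))%:E.
Proof. by rewrite inE => h; rewrite fineK// ge0_fin_numE// sqsum_ge0. Qed.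

Lemma normcD_le (a b : R[i]) : normc (a + b) <= normc a + normc b.
Proof. exact: le_normcD. Qed.

Lemma normc_ge0 (a : R[i]) : 0 <= normc a.
Proof. by case: a => a b; rewrite /normc sqrtr_ge0. Qed.

Lemma ell2_norm_ge0 x : 0 <= ell2_norm x.
Proof. exact: sqrtr_ge0. Qed.

Lemma ell2_norm_leP x (M : R) : 0 <= M ->
  (x \in ell2_pred) && (ell2_norm x <= M) <->
  (forall s, uniq s -> \sum_(i <- s) normc (x i) ^+ 2 <= M ^+ 2).
Proof.
move=> M0; rewrite -sqsum_leP.
have E : x \in ell2_pred ->
    (ell2_norm x <= M) = (sqsum x <= (M ^+ 2)%:E)%E.
  move=> xl; rewrite (sqsum_fin xl) lee_fin /ell2_norm.
  rewrite -[in LHS](ger0_norm M0) -sqrtr_sqr ler_psqrt// ?nnegrE ?sqr_ge0//.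
  by rewrite fine_ge0// sqsum_ge0.
split=> [/andP[xl]|h]; first by rewrite E.
have xl : x \in ell2_pred by rewrite inE (le_lt_trans h)// ltry.
by rewrite xl E.
Qed.

Lemma ell2_sum_le x s : x \in ell2_pred -> uniq s ->
  \sum_(i <- s) normc (x i) ^+ 2 <= ell2_norm x ^+ 2.
Proof.
move=> xl; apply: (proj1 (ell2_norm_leP x (ell2_norm_ge0 x))).
by rewrite xl lexx.
Qed.

Lemma ell2_coord_le x i : x \in ell2_pred -> normc (x i) <= ell2_norm x.
Proof.
move=> xl; have := @ell2_sum_le x [:: i] xl isT; rewrite big_seq1.
by rewrite ler_pXn2r// nnegrE ?normc_ge0 ?ell2_norm_ge0.
Qed.

Lemma ell2D x y : x \in ell2_pred -> y \in ell2_pred ->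
  (x + y \in ell2_pred) && (ell2_norm (x + y) <= ell2_norm x + ell2_norm y).
Proof.
move=> xl yl; set a := ell2_norm x; set b := ell2_norm y.
have a0 : 0 <= a by exact: ell2_norm_ge0.
have b0 : 0 <= b by exact: ell2_norm_ge0.
suff H e : 0 < e ->
    (x + y \in ell2_pred) && (ell2_norm (x + y) <= (a + e) + (b + e)).
  have /andP[-> _] := H 1 ltr01 => /=; apply/ler_addgt0Pr => e e0.
  have /andP[_] := H (e / 2) (divr_gt0 e0 (ltr0n _ 2)).
  by rewrite addrACA -splitr.
move=> e0; have [ae be] : 0 < a + e /\ 0 < b + e.
  by rewrite !ltr_wpDl.
apply/ell2_norm_leP => [|s us]; first by rewrite addr_ge0 ?ltW.
have ha := ell2_sum_le xl us; have hb := ell2_sum_le yl us.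
set p := a + e in ae *; set q := b + e in be *.
have key i : normc ((x + y) i) ^+ 2 <=
    (p + q) / p * normc (x i) ^+ 2 + (p + q) / q * normc (y i) ^+ 2.
  set u := normc (x i); set v := normc (y i).
  have uv : normc ((x + y) i) <= u + v by exact: normcD_le.
  apply: (@le_trans _ _ ((u + v) ^+ 2)).
    by rewrite ler_pXn2r// nnegrE ?addr_ge0 ?normc_ge0.
  rewrite -subr_ge0.
  have -> : (p + q) / p * u ^+ 2 + (p + q) / q * v ^+ 2 - (u + v) ^+ 2 =
      (q * u - p * v) ^+ 2 / (p * q).
    by field; rewrite !gt_eqF.
  by rewrite divr_ge0 ?sqr_ge0// ltW// mulr_gt0.
apply: (le_trans (ler_sum _ (fun i _ => key i))).
rewrite big_split/= -!mulr_sumr.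
have pq : 0 <= p + q by rewrite addr_ge0// ltW.
have -> : (p + q) ^+ 2 = (p + q) / p * p ^+ 2 + (p + q) / q * q ^+ 2.
  by field; rewrite !gt_eqF.
apply: lerD; apply: ler_wpM2l; rewrite ?divr_ge0// ?(ltW ae) ?(ltW be)//.
  by apply: (le_trans ha); rewrite ler_pXn2r// ?nnegrE ?(ltW ae)// lerDl ltW.
by apply: (le_trans hb); rewrite ler_pXn2r// ?nnegrE ?(ltW be)// lerDl ltW.
Qed.

Lemma ell2Z_le (k : R[i]) x : x \in ell2_pred ->
  (k *: x \in ell2_pred) && (ell2_norm (k *: x) <= normc k * ell2_norm x).
Proof.
move=> xl; apply/ell2_norm_leP => [|s us].
  by rewrite mulr_ge0 ?normc_ge0 ?ell2_norm_ge0.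
under eq_bigr => i _ do rewrite [(k *: x) i]/(k * x i) normcM exprMn.
by rewrite -mulr_sumr exprMn ler_wpM2l ?sqr_ge0// ell2_sum_le.
Qed.

Lemma ell2_0 : (0 : I -> R[i]) \in ell2_pred.
Proof.
have /andP[]// : ((0 : I -> R[i]) \in ell2_pred) && (ell2_norm 0 <= 0 :> R).
apply/ell2_norm_leP => // s us.
by rewrite big1 ?sqr_ge0// => i _; rewrite normc0 expr0n.
Qed.

Lemma ell2_subsemimod_closed : GRing.subsemimod_closed ell2_pred.
Proof.
split; first split; first exact: ell2_0.
  by move=> x y xl yl; have /andP[] := ell2D xl yl.
by move=> k x xl; have /andP[] := ell2Z_le k xl.
Qed.

End SquareSummable.

Section Ell2.
Variables (R : realType) (I : choiceType).

Record ell2 := Ell2 { ell2_fun :> I -> R[i]; _ : ell2_pred ell2_fun }.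

HB.instance Definition _ := [isSub for ell2_fun].
HB.instance Definition _ := [Choice of ell2 by <:].
HB.instance Definition _ := GRing.SubChoice_isSubLmodule.Build
  R[i] (I -> R[i]) ell2_pred ell2 ell2_subsemimod_closed.

Lemma ell2_normD (x y : ell2) :
  (ell2_norm (x + y))%:C <= (ell2_norm x)%:C + (ell2_norm y)%:C.
Proof.
by rewrite -rmorphD lecR; have /andP[] := ell2D (valP x) (valP y).
Qed.

Lemma ell2_normZE (k : R[i]) (x : ell2) :
  ell2_norm (k *: x) = normc k * ell2_norm x.
Proof.
apply/eqP; rewrite eq_le; have /andP[_ ->] /= := ell2Z_le k (valP x).
have [->|k0] := eqVneq k 0; first by rewrite normc0 mul0r ell2_norm_ge0.
have nk0 : 0 < normc k.
  by rewrite lt_neqAle normc_ge0 andbT eq_sym; apply: contra k0 => /eqP /eq0_normc ->.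
have /andP[_] := ell2Z_le k^-1 (valP (k *: x)).
rewrite -[val (k *: x)]/(k *: (x : I -> _)) scalerA mulVf// scale1r normcV.
by rewrite -ler_pdivrMl ?invr_gt0// invrK.
Qed.

Lemma ell2_normZ (k : R[i]) (x : ell2) :
  (ell2_norm (k *: x))%:C = `|k| * (ell2_norm x)%:C.
Proof. by rewrite ell2_normZE rmorphM. Qed.

Lemma ell2_norm_eq0 (x : ell2) : (ell2_norm x)%:C = 0 -> x = 0.
Proof.
move=> [x0]; apply/val_inj/funext => i; apply: eq0_normc; apply/eqP.
by rewrite eq_le normc_ge0 andbT -x0; apply: ell2_coord_le; exact: (valP x).
Qed.

HB.instance Definition _ :=
  Lmodule_isNormed.Build R[i] ell2 ell2_normD ell2_normZ ell2_norm_eq0.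

Lemma ell2_normE (x : ell2) : `|x| = (ell2_norm x)%:C.
Proof. by []. Qed.

Definition ell2_basis_fun (j : I) : I -> R[i] := fun i => (i == j)%:R.

Lemma ell2_basis_subproof (j : I) :
  (ell2_basis_fun j \in ell2_pred) && (ell2_norm (ell2_basis_fun j) <= 1).
Proof.
apply/ell2_norm_leP => // s us; rewrite expr1n.
have [js|js] := boolP (j \in s).
  rewrite (bigD1_seq j)//= /ell2_basis_fun eqxx normc1 expr1n big1 ?addr0//.
  by move=> i /negbTE ->; rewrite normc0 expr0n.
rewrite big_seq big1 ?ler01// => i is_.
rewrite /ell2_basis_fun; case: eqP => [E|_]; last by rewrite normc0 expr0n.
by move: js; rewrite -E is_.
Qed.

Definition ell2_basis (j : I) : ell2 :=
  Ell2 (proj1 (andP (ell2_basis_subproof j))).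

End Ell2.

Section BoundedOperators.
Variables (R : realType) (E : choiceType).
Notation H := (ell2 R (seq E)).

Definition bop_pred : pred (H -> H) := fun f =>
  `[< linear f /\ exists M : R, forall x, ell2_norm (f x) <= M * ell2_norm x >].

Record bop := Bop { bop_fun :> H -> H; _ : bop_pred bop_fun }.

HB.instance Definition _ := [isSub for bop_fun].
HB.instance Definition _ := [Choice of bop by <:].

Lemma ell2_norm0 : ell2_norm (0 : H) = 0.
Proof. by have [] : (ell2_norm (0 : H))%:C = 0 by rewrite -ell2_normE normr0. Qed.

Lemma ler_ell2_normD (x y : H) :
  ell2_norm (x + y) <= ell2_norm x + ell2_norm y.
Proof. by rewrite -lecR rmorphD; exact: ell2_normD. Qed.

Lemma bop_linear (A : bop) : linear A.
Proof. by have /asboolP[] := valP A. Qed.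

HB.instance Definition _ (A : bop) := GRing.isLinear.Build R[i] H H *:%R A
  (bop_linear A).

Lemma bop_bounded (A : bop) :
  exists2 M : R, 0 <= M & forall x, ell2_norm (A x) <= M * ell2_norm x.
Proof.
have /asboolP[_ [M AM]] := valP A; exists (Num.max M 0).
  by rewrite le_max lexx orbT.
move=> x; apply: le_trans (AM x) _; rewrite ler_wpM2r ?ell2_norm_ge0//.
by rewrite le_max lexx.
Qed.

Lemma bop_subsemimod_closed : GRing.subsemimod_closed bop_pred.
Proof.
split; first split.
- apply/asboolP; split=> [a x y|]; first by rewrite scaler0 addr0.
  by exists 0 => x; rewrite mul0r -[X in X <= _]/(ell2_norm (0 : H)) ell2_norm0.
- move=> f g fP gP; pose A := Bop fP; pose B := Bop gP.
  have [M _ AM] := bop_bounded A; have [N _ BN] := bop_bounded B.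
  apply/asboolP; split=> [a x y|].
    rewrite -[LHS]/(A (a *: x + y) + B (a *: x + y)) !linearP addrACA.
    by rewrite -scalerDr.
  exists (M + N) => x; rewrite mulrDl; apply: le_trans (lerD (AM x) (BN x)).
  exact: ler_ell2_normD.
- move=> k f fP; pose A := Bop fP; have [M _ AM] := bop_bounded A.
  apply/asboolP; split=> [a x y|].
    rewrite -[LHS]/(k *: A (a *: x + y)) linearP scalerDr !scalerA.
    by rewrite [k * a]mulrC -scalerA.
  exists (normc k * M) => x; rewrite -mulrA.
  rewrite -[X in X <= _]/(ell2_norm (k *: A x)) ell2_normZE.
  by rewrite ler_wpM2l ?normc_ge0.
Qed.

HB.instance Definition _ := GRing.SubChoice_isSubLmodule.Build
  R[i] (H -> H) bop_pred bop bop_subsemimod_closed.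

Lemma bop_ext (A B : bop) : A =1 B -> A = B.
Proof. by move=> AB; apply/val_inj/funext. Qed.

Lemma bop_id_subproof : bop_pred (fun x => x).
Proof. by apply/asboolP; split=> //; exists 1 => x; rewrite mul1r. Qed.

Definition bop_id := Bop bop_id_subproof.

Lemma bop_comp_subproof (A B : bop) : bop_pred (A \o B).
Proof.
apply/asboolP; split=> [a x y|]; first by rewrite /= !linearP.
have [M M0 AM] := bop_bounded A; have [N _ BN] := bop_bounded B.
by exists (M * N) => x; rewrite -mulrA (le_trans (AM _))// ler_wpM2l.
Qed.

Definition bop_comp (A B : bop) := Bop (bop_comp_subproof A B).

Fact bop_mulA : associative bop_comp.
Proof. by move=> A B C; exact: bop_ext. Qed.
Fact bop_mul1 : left_id bop_id bop_comp.
Proof. by move=> A; exact: bop_ext. Qed.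
Fact bop_mulr1 : right_id bop_id bop_comp.
Proof. by move=> A; exact: bop_ext. Qed.
Fact bop_mulDl : left_distributive bop_comp +%R.
Proof. by move=> A B C; exact: bop_ext. Qed.
Fact bop_mulDr : right_distributive bop_comp +%R.
Proof. by move=> A B C; apply: bop_ext => x; exact: (linearD A). Qed.
Fact bop_one_neq0 : bop_id != 0.
Proof.
apply/eqP => /(congr1 (fun A : bop => A (ell2_basis R [::]) [::])) /eqP.
by rewrite /= /ell2_basis_fun eqxx; apply/negP; exact: oner_neq0.
Qed.

HB.instance Definition _ := GRing.Zmodule_isNzRing.Build bop
  bop_mulA bop_mul1 bop_mulr1 bop_mulDl bop_mulDr bop_one_neq0.

Fact bop_scaleAl (a : R[i]) (A B : bop) : a *: (A * B) = (a *: A) * B.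
Proof. exact: bop_ext. Qed.
Fact bop_scaleAr (a : R[i]) (A B : bop) : a *: (A * B) = A * (a *: B).
Proof. by apply: bop_ext => x; rewrite /= -[RHS]/(A (a *: B x)) linearZ. Qed.

HB.instance Definition _ := GRing.Lmodule_isLalgebra.Build R[i] bop bop_scaleAl.
HB.instance Definition _ := GRing.Lalgebra_isAlgebra.Build R[i] bop bop_scaleAr.

Definition opnorm (A : bop) : R :=
  sup [set ell2_norm (A x) | x in [set x : H | ell2_norm x <= 1]].

Lemma opnorm_has_sup (A : bop) :
  has_sup [set ell2_norm (A x) | x in [set x : H | ell2_norm x <= 1]].
Proof.
split.
  by exists (ell2_norm (A 0)), 0 => //=; rewrite ell2_norm0 ler01.
have [M M0 AM] := bop_bounded A; exists M => _ [x /= x1 <-].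
by rewrite (le_trans (AM x))// ler_piMr.
Qed.

Lemma opnorm_ge0 (A : bop) : 0 <= opnorm A.
Proof.
apply: (@le_trans _ _ (ell2_norm (A 0))); first exact: ell2_norm_ge0.
apply: sup_upper_bound; first exact: opnorm_has_sup.
by exists 0 => //=; rewrite ell2_norm0 ler01.
Qed.

Lemma opnorm_bound (A : bop) (x : H) :
  ell2_norm (A x) <= opnorm A * ell2_norm x.
Proof.
have [->|x0] := eqVneq x 0; first by rewrite linear0 ell2_norm0 mulr0.
have nx : 0 < ell2_norm x.
  rewrite lt_neqAle ell2_norm_ge0 andbT eq_sym; apply: contra x0 => /eqP xE.
  by apply/eqP/ell2_norm_eq0; rewrite xE.
set k : R[i] := ((ell2_norm x)^-1)%:C.
have kE : normc k = (ell2_norm x)^-1.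
  by rewrite /k /normc /= expr0n addr0 sqrtr_sqr ger0_norm// invr_ge0 ltW.
have : ell2_norm (A (k *: x)) <= opnorm A.
  apply: sup_upper_bound; first exact: opnorm_has_sup.
  by exists (k *: x) => //=; rewrite ell2_normZE kE mulVf// gt_eqF.
by rewrite linearZ ell2_normZE kE ler_pdivrMl// mulrC.
Qed.

Lemma opnorm_le (A : bop) (M : R) : 0 <= M ->
  (forall x, ell2_norm (A x) <= M * ell2_norm x) -> opnorm A <= M.
Proof.
move=> M0 AM; apply: ge_sup; first by case: (opnorm_has_sup A).
by move=> _ [x /= x1 <-]; rewrite (le_trans (AM x))// ler_piMr.
Qed.

Lemma opnormD (A B : bop) :
  (opnorm (A + B))%:C <= (opnorm A)%:C + (opnorm B)%:C.
Proof.
rewrite -rmorphD lecR; apply: opnorm_le => [|x].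
  by rewrite addr_ge0 ?opnorm_ge0.
rewrite mulrDl; apply: le_trans (lerD (opnorm_bound A x) (opnorm_bound B x)).
exact: ler_ell2_normD.
Qed.

Lemma opnormZ_le (k : R[i]) (A : bop) : opnorm (k *: A) <= normc k * opnorm A.
Proof.
apply: opnorm_le => [|x]; first by rewrite mulr_ge0 ?normc_ge0 ?opnorm_ge0.
rewrite -[X in X <= _]/(ell2_norm (k *: A x)) ell2_normZE -mulrA.
by rewrite ler_wpM2l ?normc_ge0// opnorm_bound.
Qed.

Lemma opnormZ (k : R[i]) (A : bop) :
  (opnorm (k *: A))%:C = `|k| * (opnorm A)%:C.
Proof.
suff -> : opnorm (k *: A) = normc k * opnorm A by rewrite rmorphM.
apply/eqP; rewrite eq_le opnormZ_le /=.
have [->|k0] := eqVneq k 0; first by rewrite normc0 mul0r opnorm_ge0.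
have nk0 : 0 < normc k.
  by rewrite lt_neqAle normc_ge0 andbT eq_sym; apply: contra k0 => /eqP /eq0_normc ->.
have := opnormZ_le k^-1 (k *: A).
by rewrite scalerA mulVf// scale1r normcV -ler_pdivrMl ?invr_gt0// invrK.
Qed.

Lemma opnorm_eq0 (A : bop) : (opnorm A)%:C = 0 -> A = 0.
Proof.
move=> [A0]; apply: bop_ext => x; apply: ell2_norm_eq0; congr (_%:C).
apply/eqP; rewrite eq_le ell2_norm_ge0 andbT.
by rewrite (le_trans (opnorm_bound A x))// A0 mul0r.
Qed.

HB.instance Definition _ :=
  Lmodule_isNormed.Build R[i] bop opnormD opnormZ opnorm_eq0.

(* [creation_fun j x] is the family of coefficients of L_j x; that this is the
   operator determined by xi_w |-> xi_(jw) is [creation_basis] below. *)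
Definition creation_fun (j : E) (x : H) : seq E -> R[i] :=
  fun w => if w is i :: w' then (if i == j then x w' else 0) else 0.

Lemma creation_fun_ell2 (j : E) (x : H) :
  (creation_fun j x \in ell2_pred) &&
  (ell2_norm (creation_fun j x) <= ell2_norm x).
Proof.
apply/ell2_norm_leP => [|s us]; first exact: ell2_norm_ge0.
pose strip (w : seq E) := if w is i :: w' then
  (if i == j then Some w' else None) else None.
have stripK : pcancel (cons j) strip by move=> w; rewrite /= eqxx.
have stripP : ocancel strip (cons j).
  by case=> //= i w; case: eqP => //= ->.
apply: (@le_trans _ _ (\sum_(w <- pmap strip s) normc (x w) ^+ 2)); last first.
  by apply: ell2_sum_le; [exact: (valP x)|exact: pmap_uniq].
rewrite big_pmap le_eqVlt; apply/orP; left; apply/eqP/eq_bigr => w _.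
have n0 : normc (0 : R[i]) ^+ 2 = 0 by rewrite normc0 expr0n.
by rewrite /creation_fun /strip; case: w => [|i w]; [|case: (i == j)].
Qed.

Definition creation_ell2 (j : E) (x : H) : H :=
  Ell2 (proj1 (andP (creation_fun_ell2 j x))).

Lemma creation_subproof (j : E) : bop_pred (creation_ell2 j).
Proof.
apply/asboolP; split=> [a x y|]; last first.
  by exists 1 => x; rewrite mul1r; have /andP[] := creation_fun_ell2 j x.
apply/val_inj/funext => -[|i w] /=.
  by rewrite -[RHS]/(a * 0 + 0) mulr0 addr0.
rewrite -[RHS]/(a * (if i == j then x w else 0) + (if i == j then y w else 0)).
by case: eqP => // _; rewrite mulr0 addr0.
Qed.

Definition creation (j : E) : bop := Bop (creation_subproof j).

Lemma creation_basis (j : E) (w : seq E) :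
  creation j (ell2_basis R w) = ell2_basis R (j :: w).
Proof.
apply/val_inj/funext => -[|i u] //=; rewrite /ell2_basis_fun eqseq_cons.
by case: eqP.
Qed.

Definition disc_set : set bop :=
  smallest [set S : set bop | closed S /\ GRing.subalg_closed [in S]]
           (1 |` range creation).

Definition disc_pred : pred bop := [in disc_set].

Record disc_algebra := DiscAlgebra { disc_val :> bop; _ : disc_pred disc_val }.

HB.instance Definition _ := [isSub for disc_val].
HB.instance Definition _ := [Choice of disc_algebra by <:].

Lemma disc_closed : closed disc_set.
Proof. by apply: closed_bigI => S [[]]. Qed.

Lemma disc_subalg_closed : GRing.subalg_closed disc_pred.
Proof.
split.
- by rewrite inE => S [[_ [S1 _ _]] _]; rewrite inE in S1.
- move=> a A B; rewrite !inE => hA hB S SP; have [[_ [_ SL _]] _] := SP.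
  by have := SL a A B; rewrite !inE; apply; [exact: hA|exact: hB].
- move=> A B; rewrite !inE => hA hB S SP; have [[_ [_ _ SM]] _] := SP.
  by have := SM A B; rewrite !inE; apply; [exact: hA|exact: hB].
Qed.

HB.instance Definition _ := GRing.SubChoice_isSubAlgebra.Build
  R[i] bop disc_pred disc_algebra (GRing.subalg_closed_semi disc_subalg_closed).

Lemma creation_disc (j : E) : disc_pred (creation j).
Proof.
by rewrite /disc_pred /= inE; apply: sub_gen_smallest; right; exists j.
Qed.

Definition disc_gen (j : E) : disc_algebra := DiscAlgebra (creation_disc j).

End BoundedOperators.

Section Derivations.
Variables (K : pzRingType) (A : lalgType K).

Definition is_derivation (delta : {linear A -> A}) :=
  forall a b : A, delta (a * b) = delta a * b + a * delta b.

Definition inner_derivation (t : A) : A -> A := fun a => a * t - t * a.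

End Derivations.

(* The number of loops is an element of [option nat], with [None] for infinity;
   loops are numbered from 1. *)
Definition le_loops (k : nat) (N : option nat) : bool :=
  if N is Some n then (k <= n)%N else true.

Definition loop (N : option nat) : Type := {j : nat | (0 < j)%N && le_loops j N}.

HB.instance Definition _ (N : option nat) := Countable.on (loop N).

Lemma loop1_subproof N : le_loops 2 N -> (0 < 1)%N && le_loops 1 N.
Proof. by case: N => //= n /ltnW. Qed.

Definition loop1 N (hN : le_loops 2 N) : loop N :=
  exist _ 1%N (loop1_subproof hN).

(* Main.v *)
From HB Require Import structures.
Require Import Defs.
From mathcomp Require Import all_boot all_order all_algebra.
From mathcomp Require Import complex.
From mathcomp Require Import all_classical all_reals all_analysis.
Local Open Scope ring_scope.

Set Implicit Arguments.
Unset Strict Implicit.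
Unset Printing Implicit Defensive.
Import Order.TTheory GRing.Theory Num.Theory.
Import numFieldNormedType.Exports.
Import Normc.

(** Write L_j for the creation operators.  Subtracting the inner derivation of S
reduces the theorem to a derivation delta with delta (L_1) = 0.

Such a delta is automatically bounded ([derivation_bounded]).  If it were not,
there would be a_n with |a_n| <= 2^-n and |delta (a_n)| >= n.  The operators
L_1^n L_2 are isometries with orthogonal ranges, and the series
G_n = sum_k L_1^k L_2 a_(n+k) lies in the algebra and satisfies
G_n = L_2 a_n + L_1 G_(n+1).  Applying delta to this recursion and then the
adjoints of L_1 and L_2 bounds every |delta (a_n)| by
|delta (G_0)| + 3 |delta (L_2)| ([derivation_on_sequence_bounded]), which is
absurd.

An element a of the algebra is determined by its Fourier coefficients, the
coordinates of a xi_[] on words: a acts on sequences by convolution with them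
([disc_conv]).  For a word g write L_g for the product of its letters.  Since
delta (L_g^n) = sum_i L_g^i delta (L_g) L_g^(n-1-i) stays bounded as n grows,
two kinds of coefficients of delta (L_g) must vanish.  The coefficient c at g is
counted n times at the single word g^n, so n |c| is bounded
([coef_derivation_self]).  If y and g are comparable neither as prefixes nor as
suffixes, the coefficient c at y appears alone at each of the n distinct words
g^i y g^(n-1-i), so n |c|^2 is bounded ([coef_derivation_incomparable]).

Suitable words g give all the information needed.  For a letter j other than 1
and m large, g = 1^m j 1^m shows that delta (L_j) has coefficients only at the
words j 1^k and 1^k j with k >= 1 ([coef_gen_supp]); for letters i, j other than
1, g = i j shows that the coefficient of delta (L_i) at i 1^k is opposite to that
of delta (L_j) at 1^k j ([coef_pair]).  Hence, with f_k the coefficient of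
delta (L_2) at 2 1^k, every delta (L_j) has the coefficients of L_j T - T L_j for
the formal series T = sum_k f_k L_1^k.  This T is a genuine element of the
algebra, because it is the backward shift of delta (L_2) along the letter 2
([backward_shift_disc]).  So delta and the inner derivation of T agree on
generators ([implementer_gen]), and by boundedness everywhere
([derivation_eq_inner]). *)

(** * Archimedean estimates *)

Section Archimedean.
Context {R : realType}.
Implicit Types c K : R.

Lemma le0_by_small c K : 0 <= K ->
  (forall e : R, 0 < e -> c <= K * e) -> c <= 0.
Proof.
move=> K0 h; apply/ler_addgt0Pr => e e0; rewrite add0r.
have K1 : 0 < K + 1 by rewrite ltr_wpDl.
rewrite (le_trans (h _ (divr_gt0 e0 K1)))// mulrCA ler_piMr ?(ltW e0)//.
by rewrite ler_pdivrMr// mul1r lerDl ler01.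
Qed.

Lemma le0_by_archimedes c K : (forall n : nat, n%:R * c <= K) -> c <= 0.
Proof.
move=> h; rewrite leNgt; apply/negP => c0.
have K0 : 0 <= K by have := h 0%N; rewrite mul0r.
have := h (Num.Def.archi_bound (K / c)).
rewrite -ler_pdivlMr// leNgt; apply/negP/negPn.
by apply: archi_boundP; rewrite divr_ge0// ltW.
Qed.

End Archimedean.

(** * Operator norm and membership in the algebra *)

Section OperatorNorm.
Local Open Scope classical_set_scope.
Local Open Scope complex_scope.
Context {R : realType} {E : choiceType}.
Implicit Types (A B C : bop R E) (j : E) (w : seq E).

Lemma bop_normE A : `|A| = (opnorm A)%:C.
Proof. by []. Qed.

Lemma opnorm0 : opnorm (0 : bop R E) = 0.
Proof. by have [] : (opnorm (0 : bop R E))%:C = 0 by rewrite -bop_normE normr0. Qed.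

Lemma opnorm_triangle A B : opnorm (A + B) <= opnorm A + opnorm B.
Proof. by rewrite -lecR rmorphD; exact: opnormD. Qed.

Lemma opnormZE (k : R[i]) A : opnorm (k *: A) = normc k * opnorm A.
Proof. by have := opnormZ k A; rewrite -rmorphM => -[]. Qed.

Lemma opnormN A : opnorm (- A) = opnorm A.
Proof. by have := normrN A; rewrite !bop_normE => -[]. Qed.

Lemma opnormB A B : opnorm (A - B) <= opnorm A + opnorm B.
Proof. by rewrite -(opnormN B); exact: opnorm_triangle. Qed.

Lemma opnormM A B : opnorm (A * B) <= opnorm A * opnorm B.
Proof.
apply: opnorm_le => [|x]; first by rewrite mulr_ge0 ?opnorm_ge0.
rewrite -mulrA (le_trans (opnorm_bound A (B x)))// ler_wpM2l ?opnorm_ge0//.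
exact: opnorm_bound.
Qed.

Lemma opnormMl_le A B : opnorm A <= 1 -> opnorm (A * B) <= opnorm B.
Proof.
by move=> A1; rewrite (le_trans (opnormM A B))// ler_piMl ?opnorm_ge0.
Qed.

Lemma opnorm_creation j : opnorm (creation R j) <= 1.
Proof.
by apply: opnorm_le => // x; rewrite mul1r; have /andP[] := creation_fun_ell2 j x.
Qed.

Lemma disc_closedP B :
  (forall e : R, 0 < e -> exists2 A, disc_pred A & opnorm (B - A) <= e) ->
  disc_pred B.
Proof.
move=> h; rewrite /disc_pred /= inE; apply: disc_closed => U.
rewrite -nbhs_ballE => -[e /= e0 eU].
have [e1 e1E] : exists r : R, e = r%:C.
  by exists (complex.Re e); apply/esym/RRe_real/gtr0_real.
have e10 : 0 < e1 by rewrite e1E ltcR in e0.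
have [A dA AB] := h (e1 / 2) (divr_gt0 e10 (ltr0n _ 2)).
exists A; split; first by move: dA; rewrite /disc_pred /= inE.
apply: eU; rewrite -ball_normE /= bop_normE e1E ltcR (le_lt_trans AB)//.
by rewrite gtr_pMr// invf_lt1 ?ltr1n.
Qed.

(** The usable form of the minimality of the algebra: closedness is expressed by
approximation in the real-valued operator norm. *)
Lemma disc_ind (P : bop R E -> Prop) :
  P 1 ->
  (forall (k : R[i]) A B, P A -> P B -> P (k *: A + B)) ->
  (forall A B, P A -> P B -> P (A * B)) ->
  (forall j, P (creation R j)) ->
  (forall B, (forall e : R, 0 < e -> exists2 A, P A & opnorm (B - A) <= e) ->
    P B) ->
  forall A, disc_pred A -> P A.
Proof.
move=> P1 PL PM PG PC A; rewrite /disc_pred /= inE => dA.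
apply: (dA [set B | P B]); split; last first.
  by move=> _ [->|[j _ <-]]; [exact: P1|exact: PG].
split; last first.
  split=> [|k B C|B C]; rewrite !inE; [exact: P1|exact: PL|exact: PM].
move=> B cB; apply: PC => e e0.
have e0C : 0 < e%:C by rewrite ltcR.
have [A' [PA' bA']] := cB _ (nbhsx_ballx B _ e0C).
exists A' => //; apply: ltW.
by move: bA'; rewrite -ball_normE /= bop_normE ltcR.
Qed.

Lemma discD A B : disc_pred A -> disc_pred B -> disc_pred (A + B).
Proof. by move=> hA hB; exact: valP (DiscAlgebra hA + DiscAlgebra hB). Qed.
Lemma discM A B : disc_pred A -> disc_pred B -> disc_pred (A * B).
Proof. by move=> hA hB; exact: valP (DiscAlgebra hA * DiscAlgebra hB). Qed.
Lemma discZ k A : disc_pred A -> disc_pred (k *: A).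
Proof. by move=> hA; exact: valP (k *: DiscAlgebra hA). Qed.

(** The annihilation operators are the adjoints of the creation operators; they
serve to read off the components of a vector along the ranges of the latter. *)
Definition annihilation_fun j (x : ell2 R (seq E)) : seq E -> R[i] :=
  fun w => x (j :: w).

Lemma annihilation_fun_ell2 j x :
  (annihilation_fun j x \in ell2_pred) &&
  (ell2_norm (annihilation_fun j x) <= ell2_norm x).
Proof.
apply/ell2_norm_leP => [|s us]; first exact: ell2_norm_ge0.
rewrite -(big_map (cons j) xpredT (fun w => normc (x w) ^+ 2)).
apply: ell2_sum_le; first exact: (valP x).
by rewrite map_inj_uniq// => u v [].
Qed.

Definition annihilation_ell2 j x : ell2 R (seq E) :=
  Ell2 (proj1 (andP (annihilation_fun_ell2 j x))).

Lemma annihilation_subproof j : bop_pred (annihilation_ell2 j).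
Proof.
apply/asboolP; split=> [a x y|]; first exact/val_inj/funext.
exists 1 => x; rewrite mul1r.
by have /andP[] := annihilation_fun_ell2 j x.
Qed.

Definition annihilation j : bop R E := Bop (annihilation_subproof j).

Lemma opnorm_annihilation j : opnorm (annihilation j) <= 1.
Proof.
apply: opnorm_le => // x; rewrite mul1r.
by have /andP[] := annihilation_fun_ell2 j x.
Qed.

Lemma annihilation_creation i j :
  annihilation i * creation R j = (i == j)%:R.
Proof.
apply: bop_ext => x; apply/val_inj/funext => w /=.
by rewrite /annihilation_fun /=; case: eqP.
Qed.

End OperatorNorm.

(** * Fourier coefficients *)

Section FourierCoefficients.
Local Open Scope complex_scope.
Context {R : realType} {E : choiceType}.
Implicit Types (A B C : bop R E) (j : E) (u v w : seq E) (b c x : seq E -> R[i]).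

Definition coef B : seq E -> R[i] := B (ell2_basis R [::]).

(** Convolution over the free semigroup: the sum of b u * x v over the finitely many
factorizations w = u v.  Recursion on w makes associativity a plain induction. *)
Fixpoint conv b x w : R[i] :=
  if w is i :: w' then b [::] * x w + conv (fun v => b (i :: v)) x w'
  else b [::] * x [::].

Lemma eq_conv b c x : b =1 c -> conv b x =1 conv c x.
Proof.
move=> bc w; elim: w b c bc => [|i w IH] b c bc /=; first by rewrite bc.
by rewrite bc (IH _ (fun v => c (i :: v))).
Qed.

Lemma conv_linearl (k : R[i]) b c x w :
  conv (fun v => k * b v + c v) x w = k * conv b x w + conv c x w.
Proof.
elim: w b c => [|i w IH] b c /=; first by rewrite mulrDl mulrA.
by rewrite IH mulrDl mulrDr mulrA addrACA.
Qed.

Lemma convA b c x w : conv (conv b c) x w = conv b (conv c x) w.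
Proof.
elim: w b => [|i w IH] b /=; first by rewrite mulrA.
by rewrite conv_linearl IH mulrDr !mulrA addrA.
Qed.

Lemma conv0 x w : conv (fun=> 0) x w = 0.
Proof. by elim: w => [|i w IH] /=; rewrite ?IH mul0r// addr0. Qed.


Lemma eq_convr b (x y : seq E -> R[i]) : x =1 y -> conv b x =1 conv b y.
Proof. by move=> xy w; elim: w b => [|i w IH] b /=; rewrite xy// IH. Qed.

Lemma conv_bound (e M : R) b x w : (forall v, normc (b v) <= e) ->
  (forall v, normc (x v) <= M) ->
  normc (conv b x w) <= (size w).+1%:R * (e * M).
Proof.
move=> be xM; have eM v v' : normc (b v * x v') <= e * M.
  by rewrite normcM ler_pM ?normc_ge0.
elim: w b be eM => [|i w IH] b be eM /=; first by rewrite mul1r.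
rewrite -natr1 mulrDl mul1r addrC (le_trans (le_normcD _ _))// lerD//.
exact: IH.
Qed.

Lemma conv_basis0 x w : conv (ell2_basis R [::]) x w = x w.
Proof.
by case: w => [|i w] /=; rewrite /ell2_basis_fun eqxx mul1r// conv0 addr0.
Qed.

Lemma conv_basis1 j x w : conv (ell2_basis R [:: j]) x w =
  if w is i :: w' then if i == j then x w' else 0 else 0.
Proof.
case: w => [|i w] /=; rewrite /ell2_basis_fun ?mul0r// add0r.
case: eqVneq => [->|ij].
  rewrite -[RHS]conv_basis0; apply: eq_conv => v /=.
  by rewrite eqseq_cons eqxx.
rewrite -[RHS](conv0 x w); apply: eq_conv => v.
by rewrite eqseq_cons (negbTE ij).
Qed.

Lemma conv_basis1r_rcons b j i w :
  conv b (ell2_basis R [:: j]) (rcons w i) = if i == j then b w else 0.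
Proof.
elim: w b => [|k w IH] b /=; rewrite /ell2_basis_fun ?eqseq_cons.
  by rewrite mulr0 addr0 andbT; case: eqP; rewrite ?mulr1 ?mulr0.
by rewrite IH; case: w {IH} => [|? ?] /=; rewrite andbF mulr0 add0r.
Qed.

Lemma bop_coord_le B (x : ell2 R (seq E)) w :
  normc (B x w) <= opnorm B * ell2_norm x.
Proof.
by rewrite (le_trans (ell2_coord_le w (valP (B x))))// opnorm_bound.
Qed.

Lemma ell2_norm_basis w : ell2_norm (ell2_basis R w) <= 1.
Proof. by have /andP[] := ell2_basis_subproof R w. Qed.

Lemma coef_bound B w : normc (coef B w) <= opnorm B.
Proof.
rewrite (le_trans (bop_coord_le _ _ _))// ler_piMr ?opnorm_ge0//.
exact: ell2_norm_basis.
Qed.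

(** Convolution operators are stable under composition by [convA].  The sum at a
given word is finite, which is why the identity passes to norm limits and holds at
every vector of ell2. *)
Lemma disc_conv A (x : ell2 R (seq E)) w :
  disc_pred A -> A x w = conv (coef A) x w.
Proof.
move=> dA; move: A dA x w; apply: disc_ind.
- by move=> x w; rewrite conv_basis0.
- move=> k A B hA hB x w; rewrite -[LHS]/(k * A x w + B x w) hA hB.
  by rewrite -conv_linearl.
- move=> A B hA hB x w; rewrite -[LHS]/(A (B x) w) hA (eq_convr _ (hB x)).
  by rewrite -convA; apply: eq_conv => v; rewrite -hA.
- move=> j x w; rewrite /coef creation_basis conv_basis1.
  by case: w.
- move=> B hB x w; apply/eqP; rewrite -subr_eq0; apply/eqP.
  set n := (size w).+1%:R : R.
  apply/eq0_normc/eqP; rewrite eq_le normc_ge0 andbT.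
  apply: (@le0_by_small _ _ (ell2_norm x + n * ell2_norm x)).
    by rewrite addr_ge0 ?mulr_ge0 ?ell2_norm_ge0.
  move=> e e0; have [A hA BA] := hB e e0.
  have -> : B x w - conv (coef B) x w =
      (B - A) x w - conv (coef (B - A)) x w.
    have -> : conv (coef (B - A)) x w = conv (coef B) x w - conv (coef A) x w.
      rewrite [RHS]addrC -[in RHS]mulN1r -conv_linearl; apply: eq_conv => v.
      by rewrite mulN1r addrC.
    by rewrite -hA -[(B - A) x w]/(B x w - A x w) opprB addrA subrK.
  rewrite (le_trans (le_normcD _ _))// normcN mulrDl lerD//.
    rewrite (le_trans (bop_coord_le _ _ _))// mulrC.
    by rewrite ler_wpM2l ?ell2_norm_ge0.
  rewrite -mulrA [_ * e]mulrC; apply: conv_bound => v.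
    exact: le_trans (coef_bound _ _) BA.
  exact: (ell2_coord_le v (valP x)).
Qed.

Lemma disc_coefM A B w : disc_pred A ->
  coef (A * B) w = conv (coef A) (coef B) w.
Proof. by move=> dA; rewrite -disc_conv. Qed.

Lemma disc_coef_inj A B : disc_pred A -> disc_pred B ->
  coef A =1 coef B -> A = B.
Proof.
move=> dA dB AB; apply: bop_ext => x; apply/val_inj/funext => w.
by rewrite [LHS]disc_conv// [RHS]disc_conv//; exact: eq_conv.
Qed.

Lemma coef_creationl j B w : coef (creation R j * B) w =
  if w is i :: w' then if i == j then coef B w' else 0 else 0.
Proof. by []. Qed.

Lemma coef_creationr_nil j B : disc_pred B -> coef (B * creation R j) [::] = 0.
Proof.
move=> dB; rewrite disc_coefM// (eq_convr _ (y := ell2_basis R [:: j])).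
  by rewrite /= /ell2_basis_fun mulr0.
by move=> v; rewrite /coef creation_basis.
Qed.

Lemma coef_creationr_rcons j B w i : disc_pred B ->
  coef (B * creation R j) (rcons w i) = if i == j then coef B w else 0.
Proof.
move=> dB; rewrite disc_coefM// (eq_convr _ (y := ell2_basis R [:: j])).
  exact: conv_basis1r_rcons.
by move=> v; rewrite /coef creation_basis.
Qed.

(** The map F sending A to L_j^* (A - A_[]), where A_[] is the constant coefficient, is
continuous and satisfies F (A B) = F A * B + A_[] * F B, because A_[] is
multiplicative on the algebra; so the elements of the algebra whose image under F
lies in the algebra form a closed subalgebra containing the generators. *)
Lemma backward_shift_disc j A : disc_pred A ->
  disc_pred (annihilation j * (A - (coef A [::])%:A)).
Proof.
move=> dA; pose F B := annihilation j * (B - (coef B [::])%:A).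
suff [] : disc_pred A /\ disc_pred (F A) by [].
have d1 : disc_pred (1 : bop R E) := valP (1 : disc_algebra R E).
have d0 : disc_pred (0 : bop R E) := valP (0 : disc_algebra R E).
have FL (k : R[i]) B C : F (k *: B + C) = k *: F B + F C.
  rewrite /F; have -> : coef (k *: B + C) [::] = k * coef B [::] + coef C [::].
    by [].
  rewrite scalerAr -mulrDr; congr (_ * _).
  by rewrite scalerBr scalerA scalerDl opprD addrACA.
move: A dA; apply: disc_ind.
- split=> //; rewrite /F.
  have -> : coef (1 : bop R E) [::] = 1 by rewrite /coef /= /ell2_basis_fun eqxx.
  by rewrite scale1r subrr mulr0.
- move=> k A B [dA FA] [dB FB]; rewrite FL.
  by split; apply: discD => //; apply: discZ.
- move=> A B [dA FA] [dB FB]; split; first exact: discM.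
  have -> : F (A * B) = F A * B + coef A [::] *: F B.
    rewrite /F (disc_coefM _ _ dA) /= scalerAr -mulrA -mulrDr; congr (_ * _).
    rewrite mulrBl scalerBr -scalerAl mul1r scalerA addrA subrK.
    by [].
  by apply: discD; [exact: discM|exact: discZ].
- move=> i; split; first exact: creation_disc.
  rewrite /F.
  have -> : coef (creation R i) [::] = 0 by [].
  rewrite scale0r subr0 annihilation_creation.
  by case: (j == i).
- move=> B hB; split.
    by apply: disc_closedP => e /hB[A [dA _] AB]; exists A.
  apply: disc_closedP => e e0.
  have [A [dA FA] AB] := hB (e / 2) (divr_gt0 e0 (ltr0n _ 2)).
  exists (F A) => //.
  have -> : F B - F A = F (B - A).
    by rewrite addrC -scaleN1r -FL scaleN1r addrC.
  rewrite /F (le_trans (opnormMl_le _ (opnorm_annihilation j)))//.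
  rewrite (le_trans (opnormB _ _))// opnormZE [e]splitr lerD//.
  rewrite -[leRHS]mulr1 ler_pM ?opnorm_ge0 ?normc_ge0//.
    exact: le_trans (coef_bound _ _) AB.
  by apply: opnorm_le => // x; rewrite mul1r.
Qed.

End FourierCoefficients.

(** * Automatic continuity *)

Section AutomaticContinuity.
Local Open Scope complex_scope.
Context {R : realType} {E : choiceType}.
Notation Alg := (disc_algebra R E).
Variables (e1 e2 : E).
Hypothesis e12 : e1 != e2.

Section Series.
Variable a : nat -> Alg.
Hypothesis a_small : forall n, opnorm (a n) <= 2^-1 ^+ n.

(** The coordinates of sum_k L_1^k L_2 a_(n+k) x: a word 1^k 2 w' picks a_(n+k) x at
w', every other word gives 0.  Defining the limit coordinatewise avoids any appeal to
completeness of the space of operators. *)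
Fixpoint shifted_sum_fun n (x : ell2 R (seq E)) (w : seq E) : R[i] :=
  if w is i :: w' then
    if i == e2 then a n x w' else
    if i == e1 then shifted_sum_fun n.+1 x w' else 0
  else 0.

Fixpoint partial_sum n K : bop R E :=
  if K is K'.+1
  then creation R e2 * a n + creation R e1 * partial_sum n.+1 K' else 0.

(** The term L_1^k L_2 a_(n+k) only affects words longer than k, so each coordinate of
the series is already that of a partial sum; all bounds on the series come from
bounds on partial sums through this. *)
Lemma partial_sum_stable K n x w : (size w <= K)%N ->
  partial_sum n K x w = shifted_sum_fun n x w.
Proof.
elim: w n K => [|i w IH] n [|K] //= wK.
  by rewrite -[LHS]/(0 + 0) addr0.
rewrite -[LHS]/((if i == e2 then a n x w else 0) +
  (if i == e1 then partial_sum n.+1 K x w else 0)) IH//.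
case: (eqVneq i e2) => [->|_]; last by rewrite add0r.
by rewrite eq_sym (negbTE e12) addr0.
Qed.

Lemma opnorm_partial_sum n K : opnorm (partial_sum n K) <= 2 * 2^-1 ^+ n.
Proof.
elim: K n => [|K IH] n /=.
  by rewrite opnorm0 mulr_ge0// exprn_ge0// invr_ge0.
rewrite mulr_natl mulr2n (le_trans (opnorm_triangle _ _))// lerD//.
  exact: le_trans (opnormMl_le _ (opnorm_creation e2)) (a_small n).
apply: le_trans (opnormMl_le _ (opnorm_creation e1)) _.
by apply: le_trans (IH _) _; rewrite exprS mulrA mulfV// mul1r.
Qed.

Lemma shifted_sum_fun_ell2 n x :
  (shifted_sum_fun n x \in ell2_pred) &&
  (ell2_norm (shifted_sum_fun n x) <= 2 * 2^-1 ^+ n * ell2_norm x).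
Proof.
have h0 : 0 <= 2 * 2^-1 ^+ n :> R by rewrite mulr_ge0// exprn_ge0// invr_ge0.
apply/ell2_norm_leP => [|s us]; first by rewrite mulr_ge0 ?ell2_norm_ge0.
pose K := (\max_(w <- s) size w)%N.
have -> : \sum_(w <- s) normc (shifted_sum_fun n x w) ^+ 2 =
    \sum_(w <- s) normc (partial_sum n K x w) ^+ 2.
  apply: eq_big_seq => w ws; rewrite partial_sum_stable//.
  by apply: leq_bigmax_seq.
apply: le_trans (ell2_sum_le (valP _) us) _.
rewrite ler_pXn2r// ?nnegrE ?mulr_ge0 ?ell2_norm_ge0//.
by rewrite (le_trans (opnorm_bound _ _))// ler_wpM2r ?ell2_norm_ge0 ?opnorm_partial_sum.
Qed.

Definition shifted_sum_ell2 n x : ell2 R (seq E) :=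
  Ell2 (proj1 (andP (shifted_sum_fun_ell2 n x))).

Lemma shifted_sum_subproof n : bop_pred (shifted_sum_ell2 n).
Proof.
apply/asboolP; split=> [k x y|]; last first.
  by exists (2 * 2^-1 ^+ n) => x; have /andP[] := shifted_sum_fun_ell2 n x.
apply/val_inj/funext => w.
rewrite -[RHS]/(k * shifted_sum_fun n x w + shifted_sum_fun n y w).
rewrite -[LHS]/(shifted_sum_fun n (k *: x + y) w).
by rewrite -!(partial_sum_stable (K := size w))// linearP.
Qed.

Definition shifted_sum n := Bop (shifted_sum_subproof n).

Lemma shifted_sumS n :
  shifted_sum n = creation R e2 * a n + creation R e1 * shifted_sum n.+1.
Proof.
apply: bop_ext => x; apply/val_inj/funext => -[|i w].
  by rewrite -[RHS]/(0 + 0) addr0.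
rewrite -[LHS]/(if i == e2 then a n x w else
  if i == e1 then shifted_sum_fun n.+1 x w else 0).
rewrite -[RHS]/((if i == e2 then a n x w else 0) +
  (if i == e1 then shifted_sum_fun n.+1 x w else 0)).
case: (eqVneq i e2) => [->|_]; last by rewrite add0r.
by rewrite eq_sym (negbTE e12) addr0.
Qed.

Lemma opnorm_shifted_sum n : opnorm (shifted_sum n) <= 2 * 2^-1 ^+ n.
Proof.
apply: opnorm_le => [|x]; first by rewrite mulr_ge0// exprn_ge0// invr_ge0.
by have /andP[] := shifted_sum_fun_ell2 n x.
Qed.

(** Unfolding the recursion K times leaves the tail L_1^K G_(n+K), of norm at most
2 * 2^-(n+K). *)
Lemma shifted_sum_approx K n : exists2 A, disc_pred A &
  opnorm (shifted_sum n - A) <= 2 * 2^-1 ^+ (n + K).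
Proof.
elim: K n => [|K IH] n.
  exists 0; first exact: (valP (0 : Alg)).
  by rewrite subr0 addn0 opnorm_shifted_sum.
have [A dA hA] := IH n.+1; exists (creation R e2 * a n + creation R e1 * A).
  by apply: discD; apply: discM => //; [exact: creation_disc|exact: valP|exact: creation_disc].
rewrite shifted_sumS opprD addrACA subrr add0r -mulrBr addnS -addSn.
exact: le_trans (opnormMl_le _ (opnorm_creation e1)) hA.
Qed.

Lemma shifted_sum_disc n : disc_pred (shifted_sum n).
Proof.
apply: disc_closedP => e e0.
have [K hK] : exists K : nat, 2 * 2^-1 ^+ K <= e :> R.
  exists (Num.Def.archi_bound (2 / e)); set K := Num.Def.archi_bound _.
  have hK : 2 / e < K%:R by apply: archi_boundP; rewrite divr_ge0// ltW.
  have K2 : K%:R <= 2 ^+ K :> R by rewrite -natrX ler_nat ltnW// ltn_expl.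
  rewrite exprVn ler_pdivrMr ?exprn_gt0// mulrC -ler_pdivrMr//.
  exact: le_trans (ltW hK) K2.
have [A dA hA] := shifted_sum_approx K n; exists A => //.
apply: le_trans hA (le_trans _ hK); rewrite ler_wpM2l// exprD.
by rewrite ler_piMl// ?exprn_ge0 ?invr_ge0// exprn_ile1// ?invr_ge0// invf_le1 ?ler1n.
Qed.

Lemma shifted_series : exists G : nat -> Alg,
  forall n, G n = disc_gen R e2 * a n + disc_gen R e1 * G n.+1.
Proof.
exists (fun n => DiscAlgebra (shifted_sum_disc n)) => n.
by apply/val_inj; exact: shifted_sumS.
Qed.

End Series.

Variable delta : {linear Alg -> Alg}.
Hypothesis deltaM : is_derivation delta.
Hypothesis delta1 : delta (disc_gen R e1) = 0.

(** With G_n = L_2 a_n + L_1 G_(n+1) and D = delta (L_2), the derivation gives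
delta (G_n) - D a_n = L_2 delta (a_n) + L_1 delta (G_(n+1)), in which both components
are recovered by annihilation operators of norm at most 1.  The L_1 component bounds
all delta (G_n) by recursion, the L_2 component then bounds delta (a_n). *)
Lemma derivation_on_sequence_bounded (a : nat -> Alg) :
  (forall n, opnorm (a n) <= 2^-1 ^+ n) ->
  exists K : R, forall n, opnorm (delta (a n)) <= K.
Proof.
move=> a_small; have [G GE] := shifted_series a_small.
pose D := opnorm (delta (disc_gen R e2)).
have D0 : 0 <= D by exact: opnorm_ge0.
have Da n : opnorm (delta (disc_gen R e2) * a n : Alg) <= D * 2^-1 ^+ n.
  by rewrite (le_trans (opnormM _ _))// ler_wpM2l ?a_small.
have dG n : (delta (G n) : bop R E) = disc_val (delta (disc_gen R e2)) * a n +
    creation R e2 * delta (a n) + creation R e1 * delta (G n.+1).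
  by rewrite {1}GE linearD !deltaM delta1 mul0r add0r.
have dG0 n : (delta (G n) : bop R E) - disc_val (delta (disc_gen R e2)) * a n =
    creation R e2 * delta (a n) + creation R e1 * delta (G n.+1).
  by apply/eqP; rewrite subr_eq dG [eqbRHS]addrC addrA.
have e21 : e2 == e1 = false by rewrite eq_sym; exact: negbTE.
have dG1 n : (delta (G n.+1) : bop R E) =
    annihilation e1 * ((delta (G n) : bop R E) - disc_val (delta (disc_gen R e2)) * a n).
  rewrite dG0 mulrDr !mulrA !annihilation_creation.
  by rewrite (negbTE e12) eqxx mul0r add0r mul1r.
have dG2 n : (delta (a n) : bop R E) =
    annihilation e2 * ((delta (G n) : bop R E) - disc_val (delta (disc_gen R e2)) * a n).
  rewrite dG0 mulrDr !mulrA !annihilation_creation.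
  by rewrite e21 eqxx mul0r addr0 mul1r.
(* The subtracted term makes 2 - 2 * 2^-n the sum of 2^-k over k < n. *)
have bound n : opnorm (delta (G n)) <=
    opnorm (delta (G 0%N)) + D * (2 - 2 * 2^-1 ^+ n).
  elim: n => [|n IH]; first by rewrite expr0 mulr1 subrr mulr0 addr0.
  rewrite dG1; apply: le_trans (opnormMl_le _ (opnorm_annihilation e1)) _.
  apply: le_trans (opnormB _ _) _; apply: le_trans (lerD IH (Da n)) _.
  rewrite -addrA -mulrDr lerD2l ler_wpM2l// exprS mulrA mulfV// mul1r.
  by rewrite -addrA lerD2l mulr_natl mulr2n opprD -addrA addNr addr0.
exists (opnorm (delta (G 0%N)) + D * 2 + D * 1) => n.
rewrite dG2; apply: le_trans (opnormMl_le _ (opnorm_annihilation e2)) _.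
have h0 : 0 <= 2^-1 ^+ n :> R by rewrite exprn_ge0// invr_ge0.
apply: le_trans (opnormB _ _) _; apply: lerD.
  apply: le_trans (bound n) _; rewrite lerD2l ler_wpM2l//.
  by rewrite gerBl mulr_ge0.
apply: le_trans (Da n) _; rewrite ler_wpM2l//.
by rewrite exprn_ile1// ?invr_ge0// invf_le1 ?ler1n.
Qed.

(** An unbounded delta would be large on a sequence of norms at most 2^-n, obtained by
rescaling witnesses of unboundedness. *)
Lemma derivation_bounded : exists2 C : R, 0 <= C &
  forall a, opnorm (delta a) <= C * opnorm a.
Proof.
have [[C hC]|no_bound] := pselect
    (exists C : R, forall a, opnorm (delta a) <= C * opnorm a).
  exists (Num.max C 0) => [|a]; first by rewrite le_max lexx orbT.
  by rewrite (le_trans (hC a))// ler_wpM2r ?opnorm_ge0// le_max lexx.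
exfalso.
have large n : exists a : Alg,
    opnorm a <= 2^-1 ^+ n /\ n%:R <= opnorm (delta a).
  have [a ha] : exists a : Alg, n%:R * 2 ^+ n * opnorm a < opnorm (delta a).
    apply: contrapT => h; apply: no_bound; exists (n%:R * 2 ^+ n) => a.
    by rewrite leNgt; apply/negP => ha; apply: h; exists a.
  have a0 : 0 < opnorm a.
    rewrite lt_neqAle opnorm_ge0 andbT eq_sym; apply/eqP => a0.
    have a00 : a = 0 by apply/val_inj/opnorm_eq0; rewrite a0.
    by move: ha; rewrite a0 mulr0 a00 linear0 opnorm0 ltxx.
  pose k : R[i] := ((2 ^+ n * opnorm a)^-1)%:C.
  have t0 : 0 < 2 ^+ n * opnorm a by rewrite mulr_gt0// exprn_gt0.
  have kE : normc k = (2 ^+ n * opnorm a)^-1.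
    by rewrite /k /normc /= expr0n addr0 sqrtr_sqr ger0_norm// invr_ge0 ltW.
  exists (k *: a); rewrite linearZ !opnormZE kE; split.
    by rewrite invfM -mulrA mulVf ?gt_eqF// mulr1 exprVn.
  by rewrite mulrC ler_pdivlMr// mulrA ltW.
have [a ha] := choice large.
have [K hK] := derivation_on_sequence_bounded (fun n => (ha n).1).
suff : (1 : R) <= 0 by rewrite ler10.
apply: (@le0_by_archimedes _ _ K) => n; rewrite mulr1.
exact: le_trans (ha n).2 (hK n).
Qed.

End AutomaticContinuity.

(** * Words *)

Section Words.
Context {E : eqType}.
Implicit Types (g r s u w y : seq E) (e j : E).

(** No word has both y and g as prefixes, nor both as suffixes. *)
Definition bifix_incomparable y g :=
  (forall r s, y ++ r <> g ++ s) /\ (forall r s, r ++ y <> s ++ g).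

Definition wpower g n := flatten (nseq n g).

Lemma cat_injl w u r : w ++ u = w ++ r -> u = r.
Proof. by move=> /eqP; rewrite eqseq_cat// => /andP[_ /eqP]. Qed.

Lemma cat_injr w u r : u ++ w = r ++ w -> u = r.
Proof.
move=> h; have/eqP := h; rewrite eqseq_cat => [/andP[/eqP //]|].
by move/(congr1 size)/eqP: h; rewrite !size_cat eqn_add2r => /eqP.
Qed.

Lemma wpowerD g m n : wpower g (m + n) = wpower g m ++ wpower g n.
Proof. by rewrite /wpower nseqD flatten_cat. Qed.

Lemma wpowerS g m : wpower g m.+1 = g ++ wpower g m.
Proof. by []. Qed.

Lemma wpowerSr g m : wpower g m.+1 = wpower g m ++ g.
Proof. by rewrite -addn1 wpowerD /wpower /= cats0. Qed.

Definition substituted g y n i := wpower g i ++ y ++ wpower g (n.-1 - i).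

(** If i < k, cancelling the common prefix g^i makes y and g prefixes of one word; if
k < i, cancelling the common suffix makes them suffixes of one word. *)
Lemma substituted_inj g y z n i k : bifix_incomparable y g -> (i < n)%N -> (k < n)%N ->
  substituted g y n i = substituted g z n k -> i = k.
Proof.
move=> [pre suf] lt_in lt_kn; rewrite /substituted.
case: (ltngtP i k) => // ik.
  have -> : k = (i + (k - i.+1).+1)%N by rewrite addnS -addSn subnKC.
  by rewrite wpowerD wpowerS -!catA => /cat_injl /pre.
have -> : (n.-1 - k = (i - k.+1).+1 + (n.-1 - i))%N.
  case: n lt_in lt_kn => // n /= lt_in lt_kn.
  by rewrite -subSn// subSS addnC addnBA ?(ltnW ik)// subnK.
by rewrite wpowerD wpowerSr !catA => /cat_injr /suf.
Qed.

Lemma substituted_self g n i : (i < n)%N -> substituted g g n i = wpower g n.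
Proof.
case: n => // n lt_in; rewrite /substituted -wpowerS -wpowerD addnS /=.
by rewrite subnKC.
Qed.

Lemma cat_nseq_inv e j m u r s : j != e -> (size u < m)%N ->
  u ++ nseq m e ++ r = j :: nseq m e ++ s -> u = j :: nseq (size u).-1 e.
Proof.
case: m => // m je; case: u => [_ [] /esym/eqP|i u /=].
  by rewrite (negbTE je).
rewrite ltnS => um [-> eq_us]; congr (_ :: _).
have um1 : (size u <= m.+1)%N by exact: leqW (ltnW um).
transitivity (take (size u) (nseq m.+1 e ++ s)).
  by rewrite /= -eq_us take_cat ltnn subnn take0 cats0.
by rewrite takel_cat ?size_nseq// (take_nseq _ um1).
Qed.

(** The padding is longer than u, so that a comparison of u e^m with j e^m forces u to
be j followed by letters e; and symmetrically for suffixes. *)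
Lemma padded_incomparable e j m u : j != e -> (size u < m)%N ->
  (forall k, u <> j :: nseq k e) -> (forall k, u <> rcons (nseq k e) j) ->
  bifix_incomparable (nseq m e ++ u ++ nseq m e) (nseq m e ++ j :: nseq m e).
Proof.
move=> je um uj ju; split=> r s.
  by rewrite -!catA => /cat_injl /(cat_nseq_inv je um); exact: uj.
move=> /(congr1 rev); rewrite !(rev_cat, rev_cons) !rev_nseq -!catA cat_rcons.
move=> /cat_injl /cat_nseq_inv; rewrite size_rev => /(_ je um) /(congr1 rev).
by rewrite revK rev_cons rev_nseq; exact: ju.
Qed.

Lemma pair_incomparable e i j k : i != e -> j != e ->
  bifix_incomparable (i :: nseq k.+1 e ++ [:: j]) [:: i; j].
Proof.
move=> ie je; split=> r s; first by case=> /eqP; rewrite eq_sym (negbTE je).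
move=> /(congr1 rev); rewrite !(rev_nseq, rev_cat, rev_cons) /=.
by case=> /eqP; rewrite eq_sym (negbTE ie).
Qed.

End Words.

(** * Products of generators *)

Section WordOperators.
Local Open Scope complex_scope.
Context {R : realType} {E : choiceType}.
Notation Alg := (disc_algebra R E).
Implicit Types (a b : Alg) (p q u w : seq E) (j : E).

Definition word_op p : Alg := \prod_(j <- p) disc_gen R j.

Lemma word_opD p q : word_op (p ++ q) = word_op p * word_op q.
Proof. exact: big_cat. Qed.

Lemma word_op1 j : word_op [:: j] = disc_gen R j.
Proof. by rewrite /word_op big_seq1. Qed.

Lemma word_opX p n : word_op p ^+ n = word_op (wpower p n).
Proof.
elim: n => [|n IH]; first by rewrite /word_op /wpower big_nil.
by rewrite exprS IH wpowerS word_opD.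
Qed.

Lemma opnorm_word p : opnorm (word_op p) <= 1.
Proof.
elim: p => [|j p IH]; rewrite /word_op ?big_nil ?big_cons.
  by apply: opnorm_le => // x; rewrite mul1r.
exact: le_trans (opnormMl_le _ (opnorm_creation j)) IH.
Qed.

Lemma coef_wordl p a w : coef (word_op p * a) (p ++ w) = coef a w.
Proof.
elim: p => [|j p IH]; first by rewrite /word_op big_nil mul1r.
by rewrite /word_op big_cons -mulrA coef_creationl /= eqxx.
Qed.

Lemma coef_wordl_supp p a u : coef (word_op p * a) u != 0 ->
  exists w, u = p ++ w.
Proof.
elim: p u => [|j p IH] u; first by exists u.
rewrite /word_op big_cons -mulrA coef_creationl.
case: u => [|i u] /=; first by rewrite eqxx.
by case: (eqVneq i j) => [-> /IH[w ->]|_]; [exists w|rewrite eqxx].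
Qed.

Lemma word_op_rcons p j : word_op (rcons p j) = word_op p * disc_gen R j.
Proof. by rewrite -cats1 word_opD word_op1. Qed.

Lemma coef_wordr q a w : coef (a * word_op q) (w ++ q) = coef a w.
Proof.
elim/last_ind: q => [|q j IH]; first by rewrite /word_op big_nil mulr1 cats0.
rewrite word_op_rcons mulrA -rcons_cat coef_creationr_rcons ?eqxx//.
exact: valP.
Qed.

Lemma coef_wordr_supp q a u : coef (a * word_op q) u != 0 ->
  exists w, u = w ++ q.
Proof.
elim/last_ind: q u => [|q j IH] u; first by exists u; rewrite cats0.
rewrite word_op_rcons mulrA; case/lastP: u => [|u i].
  by rewrite coef_creationr_nil ?eqxx//; exact: valP.
rewrite coef_creationr_rcons; last exact: valP.
by case: (eqVneq i j) => [-> /IH[w ->]|_]; [exists w; rewrite rcons_cat|rewrite eqxx].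
Qed.

Lemma coef_wordlr p q a w :
  coef (word_op p * a * word_op q) (p ++ w ++ q) = coef a w.
Proof. by rewrite catA coef_wordr coef_wordl. Qed.

Lemma coef_wordlr_supp p q a u : coef (word_op p * a * word_op q) u != 0 ->
  exists w, u = p ++ w ++ q.
Proof.
move=> h; have [w uE] := coef_wordr_supp h; move: h; rewrite uE coef_wordr.
by move=> /coef_wordl_supp[v ->]; exists v; rewrite catA.
Qed.

Lemma coef_sum (I : Type) (s : seq I) (F : I -> Alg) w :
  coef (\sum_(i <- s) F i) w = \sum_(i <- s) coef (F i) w.
Proof.
elim: s => [|i s IH]; first by rewrite !big_nil.
by rewrite !big_cons -IH.
Qed.

End WordOperators.

(** * Coefficients killed by boundedness *)

Section BoundedDerivation.
Local Open Scope complex_scope.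
Context {R : realType} {E : choiceType}.
Notation Alg := (disc_algebra R E).
Variable delta : {linear Alg -> Alg}.
Hypothesis deltaM : is_derivation delta.
Variable C : R.
Hypothesis C_ge0 : 0 <= C.
Hypothesis delta_bounded : forall a, opnorm (delta a) <= C * opnorm a.
Implicit Types (g y w : seq E).

Lemma derivation1 : delta 1 = 0.
Proof.
by have := deltaM 1 1; rewrite !mulr1 mul1r => /eqP; rewrite addrC -subr_eq subrr eq_sym => /eqP.
Qed.

Lemma derivationX (a : Alg) n :
  delta (a ^+ n) = \sum_(i < n) a ^+ i * delta a * a ^+ (n.-1 - i).
Proof.
elim: n => [|n IH]; first by rewrite big_ord0 derivation1.
rewrite exprS deltaM IH big_ord_recl expr0 mul1r subn0 mulr_sumr.
congr (_ + _); apply: eq_bigr => i _.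
by rewrite lift0 /= subnS predn_sub !mulrA exprS.
Qed.

Lemma coef_derivation_word_power g n w :
  coef (delta (word_op g ^+ n)) w = \sum_(i < n)
    coef (word_op (wpower g i) * delta (word_op g) *
          word_op (wpower g (n.-1 - i))) w.
Proof.
by rewrite derivationX coef_sum; apply: eq_bigr => i _; rewrite !word_opX.
Qed.

Lemma opnorm_derivation_word_power g n :
  opnorm (delta (word_op g ^+ n)) <= C.
Proof.
rewrite (le_trans (delta_bounded _))// ler_piMr// word_opX.
exact: opnorm_word.
Qed.

(** All n terms of the Leibniz rule for L_g^n contribute this same coefficient at the
word g^n, while delta (L_g^n) has norm at most C. *)
Lemma coef_derivation_self g : coef (delta (word_op g)) g = 0.
Proof.
apply: eq0_normc; apply/eqP; rewrite eq_le normc_ge0 andbT.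
apply: (@le0_by_archimedes _ _ C) => n.
apply: le_trans (opnorm_derivation_word_power g n).
apply: le_trans (coef_bound _ (wpower g n)).
rewrite coef_derivation_word_power.
rewrite (eq_bigr (fun=> coef (delta (word_op g)) g)) => [|i _]; last first.
  by rewrite -[wpower g n](substituted_self g (ltn_ord i)) coef_wordlr.
by rewrite sumr_const card_ord mulr_natl normcMn.
Qed.

(** The n distinct words g^i y g^(n-1-i) each receive this coefficient from exactly one
term of the Leibniz rule for L_g^n, so n times its squared modulus is at most the
squared ell2 norm of delta (L_g^n) xi_[], hence at most C^2. *)
Lemma coef_derivation_incomparable g y : bifix_incomparable y g ->
  coef (delta (word_op g)) y = 0.
Proof.
move=> yg; apply: eq0_normc; apply/eqP; rewrite -sqrf_eq0 eq_le sqr_ge0 andbT.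
apply: (@le0_by_archimedes _ _ (C ^+ 2)) => n.
pose X : bop R E := delta (word_op g ^+ n).
have coefX i : (i < n)%N -> coef X (substituted g y n i) = coef (delta (word_op g)) y.
  move=> lt_in; rewrite coef_derivation_word_power (bigD1 (Ordinal lt_in))//=.
  rewrite coef_wordlr big1 ?addr0// => k ki; apply/eqP/negPn/negP.
  move=> /coef_wordlr_supp[z] /(substituted_inj yg lt_in (ltn_ord k)) ik.
  by move/eqP: ki; apply; apply: val_inj.
have us : uniq [seq substituted g y n i | i <- iota 0 n].
  rewrite map_inj_in_uniq ?iota_uniq// => i k; rewrite !mem_iota !add0n /=.
  by move=> lt_in lt_kn; exact: substituted_inj.
have := ell2_sum_le (valP (X (ell2_basis R [::]))) us.
rewrite big_map (eq_big_seq (fun=> normc (coef (delta (word_op g)) y) ^+ 2)).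
  rewrite big_const_seq count_predT size_iota iter_addr_0 => h.
  rewrite mulr_natl; apply: le_trans h _; rewrite ler_pXn2r// ?nnegrE ?ell2_norm_ge0//.
  apply: le_trans (opnorm_derivation_word_power g n).
  rewrite (le_trans (opnorm_bound _ _))// ler_piMr ?opnorm_ge0//.
  exact: ell2_norm_basis.
by move=> i; rewrite mem_iota add0n => /coefX E0; congr (normc _ ^+ 2).
Qed.

End BoundedDerivation.

(** * Derivations vanishing at a generator *)

Section DiscAlgebraFacts.
Local Open Scope complex_scope.
Context {R : realType} {E : choiceType}.
Notation Alg := (disc_algebra R E).
Implicit Types a b : Alg.

Lemma coef_discB a b w : coef (a - b : Alg) w = coef a w - coef b w.
Proof. by []. Qed.

Lemma backward_shift j a : exists T : Alg,
  forall w, coef T w = coef a (j :: w).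
Proof.
exists (DiscAlgebra (backward_shift_disc j (valP a))) => w.
set c := coef a [::].
transitivity (coef a (j :: w) - c * ell2_basis R [::] (j :: w)) => //.
by rewrite /= /ell2_basis_fun mulr0 subr0.
Qed.

Lemma inner_derivationM (T : Alg) a b : inner_derivation T (a * b) =
  inner_derivation T a * b + a * inner_derivation T b.
Proof.
by rewrite /inner_derivation mulrBl mulrBr !mulrA [RHS]addrC subrKA.
Qed.

Lemma inner_derivation_linear (T : Alg) : linear (inner_derivation T).
Proof.
move=> k a b; rewrite /inner_derivation mulrDl mulrDr -scalerAl -scalerAr.
by rewrite opprD addrACA scalerBr.
Qed.

HB.instance Definition _ (T : Alg) :=
  GRing.isLinear.Build R[i] Alg Alg *:%R (inner_derivation T)
    (inner_derivation_linear T).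

End DiscAlgebraFacts.

Section NormalizedDerivation.
Local Open Scope complex_scope.
Context {R : realType} {E : choiceType}.
Notation Alg := (disc_algebra R E).
Notation L := (disc_gen R).
Variables (e1 e2 : E).
Hypothesis e12 : e1 != e2.
Variable delta : {linear Alg -> Alg}.
Hypothesis deltaM : is_derivation delta.
Hypothesis delta1 : delta (L e1) = 0.
Implicit Types (i j : E) (u w : seq E) (k m : nat).

Let e21 : e2 != e1. Proof. by rewrite eq_sym. Qed.

Let bounded := derivation_bounded e12 deltaM delta1.

Lemma coef_self w : coef (delta (word_op w)) w = 0.
Proof. by have [C C0 hC] := bounded; exact: (coef_derivation_self deltaM C0 hC). Qed.

Lemma coef_incomparable (g y : seq E) : bifix_incomparable y g -> coef (delta (word_op g)) y = 0.
Proof. by have [C C0 hC] := bounded; exact: (coef_derivation_incomparable deltaM C0 hC). Qed.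

Lemma coef_gen_self j : coef (delta (L j)) [:: j] = 0.
Proof. by rewrite -word_op1; exact: coef_self. Qed.

Lemma delta_nseq m : delta (word_op (nseq m e1)) = 0.
Proof.
elim: m => [|m IH]; rewrite /word_op ?big_nil ?big_cons.
  exact: derivation1.
by rewrite deltaM delta1 mul0r add0r IH mulr0.
Qed.

(** The word g = 1^m j 1^m sees every coefficient of delta (L_j): since delta (L_1) = 0,
delta (L_g) is L_1^m delta (L_j) L_1^m, whose coefficient at 1^m u 1^m is that of
delta (L_j) at u. *)
Lemma coef_gen_supp j u : j != e1 -> coef (delta (L j)) u != 0 ->
  exists k, u = j :: nseq k.+1 e1 \/ u = rcons (nseq k.+1 e1) j.
Proof.
move=> je u0.
have uj : u != [:: j] by apply: contraNneq u0 => ->; rewrite coef_gen_self.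
apply: contrapT => nu; move/eqP: u0; apply.
pose m := (size u).+1.
rewrite -(coef_wordlr (nseq m e1) (nseq m e1)).
have -> : word_op (nseq m e1) * delta (L j) * word_op (nseq m e1) =
    delta (word_op (nseq m e1 ++ j :: nseq m e1)).
  rewrite word_opD -cat1s word_opD word_op1 !deltaM delta_nseq mulr0 addr0.
  by rewrite mul0r add0r mulrA.
apply/coef_incomparable/padded_incomparable => // -[|k] uE.
- by rewrite uE eqxx in uj.
- by apply: nu; exists k; left.
- by rewrite uE eqxx in uj.
- by apply: nu; exists k; right.
Qed.

(** The word i 1^(k+1) j is incomparable with i j, and in
delta (L_i L_j) = delta (L_i) L_j + L_i delta (L_j) it is reached once from each
summand. *)
Lemma coef_pair i j k : i != e1 -> j != e1 ->
  coef (delta (L i)) (i :: nseq k.+1 e1) +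
  coef (delta (L j)) (rcons (nseq k.+1 e1) j) = 0.
Proof.
move=> ie je; have := coef_incomparable (pair_incomparable k ie je).
rewrite -cat1s word_opD deltaM !word_op1.
have -> (a b : Alg) w : coef (a + b : Alg) w = coef a w + coef b w by [].
have -> : coef (delta (L i) * L j : Alg) (i :: nseq k.+1 e1 ++ [:: j]) =
    coef (delta (L i)) (i :: nseq k.+1 e1).
  by rewrite -[L j]word_op1 -cat_cons coef_wordr.
by rewrite cats1 coef_creationl eqxx.
Qed.

Section Implementer.
Variable implementer : Alg.
Hypothesis coef_implementer :
  forall w, coef implementer w = coef (delta (L e2)) (e2 :: w).

Lemma coef_implementer_supp w : coef implementer w != 0 ->
  exists k, w = nseq k.+1 e1.
Proof.
rewrite coef_implementer => /(coef_gen_supp e21)[k [[->]|]]; first by exists k.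
by move=> [/eqP]; rewrite (negbTE e21).
Qed.

(** For j = 1 both sides vanish, the implementer being a series in L_1.  For any other
j both sides are supported on the words j 1^k and 1^k j, and comparing j with 2
through [coef_pair] shows that the coefficients of delta (L_j) there do not depend
on j. *)
Lemma implementer_gen j : delta (L j) = inner_derivation implementer (L j).
Proof.
apply/val_inj/disc_coef_inj; [exact: valP|exact: valP|] => u.
rewrite /inner_derivation coef_discB.
have left_term i w : coef (L i * implementer : Alg) w != 0 ->
    exists k, w = i :: nseq k.+1 e1.
  rewrite coef_creationl; case: w => [|i' w] /=; first by rewrite eqxx.
  case: (eqVneq i' i) => [->|_]; last by rewrite eqxx.
  by move=> /coef_implementer_supp[k ->]; exists k.
have right_term i w : coef (implementer * L i : Alg) w != 0 ->
    exists k, w = rcons (nseq k.+1 e1) i.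
  case/lastP: w => [|w i'].
    by rewrite coef_creationr_nil ?eqxx//; exact: valP.
  rewrite coef_creationr_rcons; last exact: valP.
  case: (eqVneq i' i) => [->|_]; last by rewrite eqxx.
  by move=> /coef_implementer_supp[k ->]; exists k.
have left_val i w : coef (L i * implementer : Alg) (i :: w) = coef implementer w.
  by rewrite coef_creationl eqxx.
have right_val i w : coef (implementer * L i : Alg) (rcons w i) = coef implementer w.
  by rewrite coef_creationr_rcons ?eqxx//; exact: valP.
have nseqSr k : nseq k.+1 e1 = rcons (nseq k e1) e1.
  by rewrite -cats1 -[[:: e1]]/(nseq 1 e1) -nseqD addn1.
have [->|je] := eqVneq j e1.
  rewrite delta1; apply/esym/eqP; rewrite subr_eq0; apply/eqP.
  have [h|/left_term[k ->]] := eqVneq (coef (L e1 * implementer : Alg) u) 0.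
    rewrite h; apply/esym/eqP/negPn/negP => /[dup] /right_term[k uE].
    rewrite uE right_val => h'; move/eqP: h; rewrite uE -nseqSr left_val.
    by rewrite (negbTE h').
  by rewrite left_val -[_ :: _]/(nseq k.+2 e1) (nseqSr k.+1) right_val.
have e2k k : coef (delta (L e2)) (e2 :: nseq k.+1 e1) = coef implementer (nseq k.+1 e1).
  by rewrite coef_implementer.
have left_coef k : coef (delta (L j)) (j :: nseq k.+1 e1) = coef implementer (nseq k.+1 e1).
  apply/eqP; rewrite -e2k -subr_eq0; apply/eqP.
  rewrite -[RHS](subrr (0 : R[i])) -{1}(coef_pair k je e21) -(coef_pair k e21 e21).
  by rewrite opprD addrACA subrr addr0.
have right_coef k : coef (delta (L j)) (rcons (nseq k.+1 e1) j) =
    - coef implementer (nseq k.+1 e1).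
  by apply/eqP; rewrite -e2k -addr_eq0 addrC coef_pair.
have left_right k k' : j :: nseq k.+1 e1 != rcons (nseq k'.+1 e1) j.
  by rewrite /= eqseq_cons (negbTE je).
have [/left_term[k ->]|hl] := boolP (coef (L j * implementer : Alg) u != 0).
  rewrite left_val left_coef.
  have [h|/right_term[k' /eqP]] := eqVneq (coef (implementer * L j : Alg) (j :: nseq k.+1 e1)) 0.
    by rewrite h subr0.
  by rewrite (negbTE (left_right _ _)).
have [/right_term[k uE]|hr] := boolP (coef (implementer * L j : Alg) u != 0).
  by rewrite uE in hl *; rewrite (eqP (negPn hl)) sub0r right_val right_coef.
rewrite (eqP (negPn hl)) (eqP (negPn hr)) subrr; apply/eqP/negPn/negP => h.
have [k [uE|uE]] := coef_gen_supp je h; move: h hl hr; rewrite uE.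
  by rewrite left_coef left_val => ->.
by rewrite right_coef right_val oppr_eq0 => ->.
Qed.

(** Agreement on generators extends to the closed algebra because both derivations
are bounded. *)
Lemma derivation_eq_inner : delta =1 inner_derivation implementer.
Proof.
have [C C0 hC] := bounded; set T := implementer.
suff h A : disc_pred A -> exists2 a : Alg, val a = A & delta a = inner_derivation T a.
  move=> a; have [b /val_inj -> //] := h _ (valP a).
move: A; apply: disc_ind.
- exists 1 => //; rewrite derivation1// /inner_derivation mulr1 mul1r subrr//.
- move=> k A B [a <- ha] [b <- hb]; exists (k *: a + b) => //.
  by rewrite !linearP ha hb.
- move=> A B [a <- ha] [b <- hb]; exists (a * b) => //.
  by rewrite deltaM ha hb inner_derivationM.
- by move=> j; exists (L j) => //; exact: implementer_gen.
move=> B hB.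
have dB : disc_pred B.
  by apply: disc_closedP => e /hB[A [a <- _] AB]; exists (val a) => //; exact: valP.
exists (DiscAlgebra dB) => //; set b := DiscAlgebra dB.
apply/eqP; rewrite -subr_eq0; apply/eqP/val_inj/opnorm_eq0; congr (_%:C).
apply/eqP; rewrite eq_le opnorm_ge0 andbT.
have K0 : 0 <= C + (opnorm T + opnorm T) by rewrite !addr_ge0 ?opnorm_ge0.
apply: (le0_by_small K0) => e e0; have [A [a <- ha] Ba] := hB e e0.
have -> : delta b - inner_derivation T b =
    delta (b - a) - inner_derivation T (b - a).
  have -> : delta (b - a) = delta b - delta a by exact: linearB.
  have -> : inner_derivation T (b - a) =
      inner_derivation T b - inner_derivation T a by exact: linearB.
  rewrite ha; move: (delta b) (inner_derivation T b) (inner_derivation T a).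
  by move=> x y z; rewrite opprB addrA subrK.
rewrite mulrDl mulrDl; apply: le_trans (opnormB _ _) (lerD _ _).
  by apply: le_trans (hC _) _; rewrite ler_wpM2l.
apply: le_trans (opnormB _ _) (lerD _ _); apply: le_trans (opnormM _ _) _.
  by rewrite mulrC ler_wpM2l ?opnorm_ge0.
by rewrite ler_wpM2l ?opnorm_ge0.
Qed.

End Implementer.

Lemma normalized_derivation_inner :
  exists T : Alg, delta =1 inner_derivation T.
Proof.
have [T hT] := backward_shift e2 (delta (L e2)).
by exists T; exact: derivation_eq_inner.
Qed.

End NormalizedDerivation.

Theorem lemma5p11 (R : realType) (N : option nat) (hN : le_loops 2 N)
    (delta : {linear disc_algebra R (loop N) -> disc_algebra R (loop N)}) :
  is_derivation delta ->
  (exists S : disc_algebra R (loop N),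
     delta (disc_gen R (loop1 hN)) =
     inner_derivation S (disc_gen R (loop1 hN))) ->
  exists T : disc_algebra R (loop N), delta =1 inner_derivation T.
Proof.
move=> deltaM [S hS].
pose e1 : loop N := loop1 hN; pose e2 : loop N := exist _ 2%N hN.
pose d : {linear disc_algebra R (loop N) -> disc_algebra R (loop N)} :=
  delta \- inner_derivation S.
have dM : is_derivation d.
  move=> a b; rewrite -[LHS]/(delta (a * b) - inner_derivation S (a * b)).
  rewrite deltaM inner_derivationM opprD addrACA.
  by rewrite -mulrBl -mulrBr.
have d1 : d (disc_gen R e1) = 0.
  by rewrite -[LHS]/(delta _ - inner_derivation S _) hS subrr.
have [T hT] := normalized_derivation_inner (e1 := e1) (e2 := e2) isT dM d1.
exists (T + S) => a.
have -> : delta a = d a + inner_derivation S a.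
  by rewrite -[d a]/(delta a - inner_derivation S a) subrK.
by rewrite hT /inner_derivation mulrDl mulrDr opprD addrACA.
Qed.
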